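(* There exists a polynomial time (randomized) $0.483$-competitive online algorithm for the dicut model.
   Context: The dicut model: there is a directed graph $G=(V,A)$ with non-negative arc weights, and an unknown ground set $\mathcal N=\{u_1,\dots,u_n\}\subseteq V$. The objective $f:2^{\mathcal N}\to\mathbb R_{\ge0}$ is the cut function: $f(S)$ is the total weight of arcs of $G$ going from a node of $S$ to a node of $V\setminus S$. The elements of $\mathcal N$ are revealed one by one in the order $u_1,\dots,u_n$, chosen by an adversary. The algorithm knows $V$, but does not know $\mathcal N$ or $n$ in advance. At any time it can query the existence and weight of every arc leaving a node that has already been revealed. It maintains solutions $S_0=\varnothing,S_1,\dots,S_n$, where immediately after $u_i$ is revealed it chooses (possibly at random) $S_i$ to be any subset of $S_{i-1}\cup\{u_i\}$, based only on the information available so far and internal randomness. Every subset of $\mathcal N$ is feasible. The algorithm is $\alpha$-competitive if $\mathbb E[f(S_n)]\ge\alpha\cdot\max_{S\subseteq\mathcal N}f(S)$ for every instance. Polynomial time means polynomial in $|V|$, with arithmetic operations and comparisons of numbers, and drawing uniformly random numbers from $[0,1]$, counted as elementary operations. *)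

(* Defs.v *)
From HB Require Import structures.
From mathcomp Require Import all_boot all_order all_algebra.
From mathcomp Require Import all_classical all_reals all_analysis.

Set Implicit Arguments.
Unset Strict Implicit.
Unset Printing Implicit Defensive.

Import Order.TTheory GRing.Theory Num.Theory.
Local Open Scope classical_set_scope.
Local Open Scope ring_scope.

(* Nodes are named 0, ..., |V| - 1; only the values of [weight] on arcs       *)
(* matter.                                                                    *)
Record digraph (R : realType) := Digraph {
  nb_nodes : nat;
  arc : rel 'I_nb_nodes;
  weight : 'I_nb_nodes -> 'I_nb_nodes -> R;
  weight_ge0 : forall u v, arc u v -> 0 <= weight u v }.

Definition node (R : realType) (G : digraph R) : finType := 'I_(nb_nodes G).

Definition cut (R : realType) (G : digraph R) (S : {set node G}) : R :=
  \sum_(u in S) \sum_(v in ~: S | arc u v) weight u v.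

(* The default value 0 is harmless: the maximum includes cut set0 = 0.        *)
Definition opt (R : realType) (G : digraph R) (N : {set node G}) : R :=
  \big[Num.max/0]_(S : {set node G} | S \subset N) cut S.

(* Algorithms are programs of a real random-access machine. It has an integer *)
(* memory and a real memory, both indexed by nat; [Dir n] is cell n, and      *)
(* [Ind n] is the cell whose index is the content of integer cell n. Reals    *)
(* have unit-cost field operations and comparisons (but no rounding to an     *)
(* integer), and the only integer operations are those of the classical       *)
(* unit-cost RAM, which serve for addressing and counting.                    *)
Inductive addr := Dir of nat | Ind of nat.

Inductive rop := RAdd | RSub | RMul | RDiv.

Inductive instr :=
| IConst of addr & nat
| IMove of addr & addr
| IAdd of addr & addr & addr
| ISub of addr & addr & addr
| RConst of addr & rat
| RMove of addr & addr
| ROp of rop & addr & addr & addr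
| GetSize of addr                       (* |V| *)
| GetNode of addr                       (* the node just revealed *)
| Draw of addr                          (* a uniform number of [0, 1] *)
| Query of addr & addr & addr & addr    (* existence, weight, tail, head *)
| Insert of addr                        (* put a node into the solution *)
| Delete of addr.

Inductive test := ILt of addr & addr | RLt of addr & addr | InSol of addr.

Inductive cmd :=
| Skip
| Do of instr
| Seq of cmd & cmd
| If of test & cmd & cmd
| While of test & cmd.

Section Machine.
Variables (R : realType) (G : digraph R).

(* [drawn] is the number of random numbers drawn so far.                      *)
Record state := State {
  imem : nat -> nat;
  rmem : nat -> R;
  sol : {set node G};
  drawn : nat }.

Definition init_state : state := State (fun=> 0%N) (fun=> 0) finset.set0 0.

Definition upd (T : Type) (f : nat -> T) (k : nat) (x : T) : nat -> T :=
  fun j => if j == k then x else f j.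

Definition loc (s : state) (a : addr) : nat :=
  match a with Dir n => n | Ind n => imem s n end.

Definition iget (s : state) (a : addr) : nat := imem s (loc s a).
Definition rget (s : state) (a : addr) : R := rmem s (loc s a).

Definition iput (s : state) (a : addr) (n : nat) : state :=
  State (upd (imem s) (loc s a) n) (rmem s) (sol s) (drawn s).
Definition rput (s : state) (a : addr) (x : R) : state :=
  State (imem s) (upd (rmem s) (loc s a) x) (sol s) (drawn s).

Definition nget (s : state) (a : addr) : option (node G) := insub (iget s a).

Definition rop_fun (o : rop) : R -> R -> R :=
  match o with
  | RAdd => fun x y => x + y
  | RSub => fun x y => x - y
  | RMul => fun x y => x * y
  | RDiv => fun x y => x / y
  end.

(* Queries about arcs that leave a node not yet revealed are answered like    *)
(* queries about absent arcs, so that they give no information.               *)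
Definition answer (seen : seq (node G)) (u v : option (node G)) : bool * R :=
  match u, v with
  | Some u, Some v =>
      if (u \in seen) && arc u v then (true, weight u v) else (false, 0)
  | _, _ => (false, 0)
  end.

(* The numbers drawn are the successive values of the sequence r. The node    *)
(* just revealed is u, and [seen] lists u_1, ..., u_i with u = u_i.           *)
Definition exec (r : nat -> R) (seen : seq (node G)) (u : node G)
    (i : instr) (s : state) : state :=
  match i with
  | IConst a n => iput s a n
  | IMove a b => iput s a (iget s b)
  | IAdd a b c => iput s a (iget s b + iget s c)%N
  | ISub a b c => iput s a (iget s b - iget s c)%N
  | RConst a q => rput s a (ratr q)
  | RMove a b => rput s a (rget s b)
  | ROp o a b c => rput s a (rop_fun o (rget s b) (rget s c))
  | GetSize a => iput s a (nb_nodes G)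
  | GetNode a => iput s a u
  | Draw a =>
      State (imem s) (upd (rmem s) (loc s a) (r (drawn s))) (sol s) (drawn s).+1
  | Query a b c d =>
      let: (e, w) := answer seen (nget s c) (nget s d) in
      State (upd (imem s) (loc s a) e) (upd (rmem s) (loc s b) w)
            (sol s) (drawn s)
  | Insert a =>
      if nget s a is Some v
      then State (imem s) (rmem s) (v |: sol s)%SET (drawn s) else s
  | Delete a =>
      if nget s a is Some v
      then State (imem s) (rmem s) (sol s :\ v)%SET (drawn s) else s
  end.

Definition holds (t : test) (s : state) : bool :=
  match t with
  | ILt a b => (iget s a < iget s b)%N
  | RLt a b => rget s a < rget s b
  | InSol a => if nget s a is Some v then v \in sol s else false
  end.

(* One elementary step, on a stack of pending commands and a state; the       *)
(* machine has halted when the stack is empty.                                *)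
Definition step (r : nat -> R) (seen : seq (node G)) (u : node G)
    (c : seq cmd * state) : seq cmd * state :=
  let: (k, s) := c in
  match k with
  | [::] => ([::], s)
  | Skip :: k' => (k', s)
  | Do i :: k' => (k', exec r seen u i s)
  | Seq c1 c2 :: k' => (c1 :: c2 :: k', s)
  | If t c1 c2 :: k' => ((if holds t s then c1 else c2) :: k', s)
  | While t c1 :: k' => (if holds t s then c1 :: k else k', s)
  end.

Definition halts_within (p : cmd) (r : nat -> R) (seen : seq (node G))
    (u : node G) (s : state) (T : nat) : bool :=
  nilp (iter T (step r seen u) ([:: p], s)).1.

(* The state in which the program halts (if it never does: s itself).         *)
Definition respond (p : cmd) (r : nat -> R) (seen : seq (node G))
    (u : node G) (s : state) : state :=
  match pselect (exists T, halts_within p r seen u s T) with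
  | left ex => (iter (ex_minn ex) (step r seen u) ([:: p], s)).2
  | right _ => s
  end.

Definition arrive (p : cmd) (r : nat -> R) (c : seq (node G) * state)
    (u : node G) : seq (node G) * state :=
  (rcons c.1 u, respond p r (rcons c.1 u) u c.2).

(* The memory and the solution after the nodes of us have been revealed, in   *)
(* this order. The program is run once per revealed node, and its memory is   *)
(* kept from one run to the next.                                             *)
Definition state_after (p : cmd) (r : nat -> R) (us : seq (node G)) : state :=
  (foldl (arrive p r) ([::], init_state) us).2.

Definition solution (p : cmd) (r : nat -> R) (us : seq (node G)) :
    {set node G} := sol (state_after p r us).

End Machine.

Section Properties.
Variables (R : realType) (p : cmd).

Definition unit_tape (r : nat -> R) : Prop := forall k, 0 <= r k <= 1.

(* Each S_i is a subset of S_(i-1) + u_i; prefixes of an input are inputs, so *)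
(* it is enough to look at the last node.                                     *)
Definition online_algorithm : Prop :=
  forall (G : digraph R) (us : seq (node G)) (u : node G) (r : nat -> R),
    unit_tape r -> uniq (rcons us u) ->
    solution p r (rcons us u) \subset (u |: solution p r us)%SET.

(* At most |V| nodes are revealed, so a bound per revealed node that is       *)
(* polynomial in |V| amounts to a polynomial bound on the total time.         *)
Definition polynomial_time : Prop :=
  exists q : {poly nat},
    forall (G : digraph R) (us : seq (node G)) (u : node G) (r : nat -> R),
      unit_tape r -> uniq (rcons us u) ->
      halts_within p r (rcons us u) u (state_after p r us) q.[nb_nodes G].

Definition independent (d : measure_display) (W : measurableType d)
    (P : probability W R) (U : nat -> {RV P >-> R}) : Prop :=
  forall (J : seq nat) (B : nat -> set R),
    uniq J -> (forall j, measurable (B j)) ->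
    P (\big[setI/setT]_(j <- J) (U j @^-1` B j)) =
    (\prod_(j <- J) P (U j @^-1` B j))%E.

Definition uniform01 (d : measure_display) (W : measurableType d)
    (P : probability W R) (X : {RV P >-> R}) : Prop :=
  forall B : set R, measurable B ->
    distribution P X B = uniform_prob (@ltr01 R) B.

(* The adversary fixes the graph and the order of arrival in advance; the     *)
(* random numbers are any independent uniform sequence.                       *)
Definition competitive (alpha : R) : Prop :=
  forall (G : digraph R) (us : seq (node G)), uniq us ->
  forall (d : measure_display) (W : measurableType d) (P : probability W R)
      (U : nat -> {RV P >-> R}),
    independent U -> (forall k, uniform01 (U k)) ->
    ((alpha * opt [set u in us]%SET)%:E <=
       'E_P[fun w => cut (solution p (fun k => U k w) us)])%E.

End Properties.

(* Main.v *)
Require Import Defs.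
From mathcomp Require Import all_boot all_order all_algebra.
From mathcomp Require Import all_classical all_reals all_analysis.
From mathcomp Require Import measurable_realfun.
From mathcomp Require Import ring lra zify.

(* Let x_v be the fraction of the weight of the arcs at v that leave v, where *)
(* only arcs leaving revealed nodes count. The algorithm of Feige and Jozeph  *)
(* selects v with probability p(x_v), independently, where p is the ramp from *)
(* 0 at x = 1/4 to 1 at x = 3/4. Implemented with one uniform threshold per   *)
(* node it is online: x_v only decreases after v is revealed, so that nodes   *)
(* are only ever deleted. For the ratio, fix a set T. For any potential L,    *)
(* the sum over the arcs uv of w(uv) ((1 - x_u) L_u - x_v L_v) is 0, because  *)
(* x_v is the fraction of the weight that leaves v. So it suffices to find L, *)
(* where L_v depends on x_v and on whether v is in T, with                    *)
(*   p(x_u) (1 - p(x_v))                                                      *)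
(*     >= 0.483 [u in T, v not in T] + (1 - x_u) L_u - x_v L_v                *)
(* for all possible arcs; each case reduces to a quadratic inequality on the  *)
(* square [0, 1]^2.                                                           *)

Set Implicit Arguments.
Unset Strict Implicit.
Unset Printing Implicit Defensive.

Import Order.TTheory GRing.Theory Num.Theory.
Local Open Scope ring_scope.

(** By [solutionE] the random solution has a closed form: a revealed node is in it iff its threshold
    is below its ratio in the final [flow]. That ratio depends on the instance only, so distinct
    revealed nodes are selected independently, and by linearity [expected_cut] charges each arc uv
    with probability p(x_u) (1 - p(x_v)). [oblivious_cut] compares this with the cut of a fixed T
    arc by arc ([arc_bound]), after adding the null sum [potential_sum0]. With a = p(x_u) and b =
    p(1 - x_v), the four positions of u and v relative to T reduce to [out_out_le], [out_in_le]
    (twice) and [in_in_le]. On the machine side, the timed Hoare triples behind [program_spec] give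
    both the effect and the quadratic cost of one arrival. *)

(** * Selection probability, potential and their scalar inequalities *)

Section Certificate.
Variable R : realFieldType.
Implicit Types x y u v : R.

Definition select_prob x : R :=
  if 4 * x <= 1 then 0 else if 3 <= 4 * x then 1 else 2 * x - 1 / 2.

(* The value of the potential on T; by the symmetry that reverses all arcs    *)
(* and complements T, it is - multiplier (1 - x) off T. It is linear on       *)
(* [1/4, 3/4]; the slope 2 makes the inequalities below depend on u + v up to *)
(* lower-order terms, and any offset close to 371/500 works. Outside, it is   *)
(* the continuous extension that makes out_term, resp. in_term, constant      *)
(* where p is 0.                                                              *)
Definition multiplier x : R :=
  if 4 * x <= 1 then - (1113 / 2000) / (1 - x)
  else if 3 <= 4 * x then (387 / 2000) / x
  else 2 * x - 1 / 2 - 371 / 500.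

Definition out_term x := (1 - x) * multiplier x.
Definition in_term x := (1 - x) * multiplier (1 - x).

(* The values of out_term and in_term on [1/4, 3/4] in terms of u = p(x).     *)
Definition out_bound u : R := (3 - 2 * u) * (u - 371 / 500) / 4.
Definition in_bound u : R := (3 - 2 * u) * (129 / 500 - u) / 4.

Lemma select_prob_itv x : 0 <= select_prob x <= 1.
Proof.
by rewrite /select_prob; case: (lerP (4 * x)) => ?; [|case: (lerP 3) => ?]; lra.
Qed.

(** Reversing all arcs exchanges x and 1 - x, so the head of an arc can be handled as a tail of the
    reversed graph. *)
Lemma select_probC x : select_prob (1 - x) = 1 - select_prob x.
Proof.
rewrite /select_prob; case: (lerP (4 * x)) => ?; [|case: (lerP 3 (4 * x)) => ?];
  (case: (lerP (4 * (1 - x))) => ?; [|case: (lerP 3 (4 * (1 - x))) => ?]); lra.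
Qed.

(** Equality holds for x <= 3/4; beyond, p(x) = 1 and (1 - x) / x is at most 1/3, its value at 3/4.
    The same holds for [in_term_ge], where this factor has a negative coefficient. *)
Lemma out_term_le x : 0 <= x <= 1 -> out_term x <= out_bound (select_prob x).
Proof.
move=> x01; rewrite /out_term /out_bound /multiplier /select_prob.
have [x_le|x_gt] := lerP (4 * x) 1.
  have x1 : 1 - x != 0 by lra.
  by rewrite mulrC divfK //; lra.
have [x3|x3] := lerP 3 (4 * x); last by nra.
have x0 : 0 < x by lra.
by rewrite mulrA ler_pdivrMr //; lra.
Qed.

Lemma in_term_ge x : 0 <= x <= 1 -> in_bound (select_prob x) <= in_term x.
Proof.
move=> x01; rewrite /in_term /in_bound /multiplier /select_prob.
have [x_le|x_gt] := lerP (4 * x) 1.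
  have [?|_] := lerP (4 * (1 - x)) 1; first lra.
  rewrite ifT; last lra.
  have x1 : 1 - x != 0 by lra.
  by rewrite (mulrC (1 - x)) divfK //; lra.
have [?|?] := lerP 3 (4 * x).
  rewrite ifT; last lra.
  have -> : 1 - (1 - x) = x by lra.
  have x0 : 0 < x by lra.
  by rewrite mulrA ler_pdivlMr //; lra.
have [?|_] := lerP (4 * (1 - x)) 1; first lra.
have [?|_] := lerP 3 (4 * (1 - x)); first lra.
nra.
Qed.

(** The product uv completes the square in s = u + v: twice the slack is (s - 1.121)^2 + 0.003359.
    For [in_in_le] it is (s - 0.879)^2 + 0.001359. *)
Lemma out_out_le u v : 483 / 1000 + out_bound u + out_bound v <= u * v.
Proof.
rewrite /out_bound -subr_ge0.
have : 0 <= (u + v - 1121 / 1000) ^+ 2 by exact: sqr_ge0.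
by nra.
Qed.

Lemma in_in_le u v : - in_bound u - in_bound v <= u * v.
Proof.
rewrite /in_bound -subr_ge0.
have : 0 <= (u + v - 879 / 1000) ^+ 2 by exact: sqr_ge0.
by nra.
Qed.

(** The slack is (u + v - 1.121)^2 / 2 + 0.242 v + 0.1216795. *)
Lemma out_in_le u v : 0 <= u <= 1 -> 0 <= v <= 1 ->
  out_bound u - in_bound v <= u * v.
Proof.
move=> ? ?; rewrite /out_bound /in_bound -subr_ge0.
have : 0 <= (u + v - 1121 / 1000) ^+ 2 by exact: sqr_ge0.
by nra.
Qed.

End Certificate.

(** * The cut inequality for a weighted digraph *)

Lemma sum_in_notin (R : pzSemiRingType) (V : finType) (c : V -> V -> R)
    (S : {set V}) :
  \sum_(u in S) \sum_(v in ~: S) c u v =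
  \sum_u \sum_v c u v * ((u \in S) && (v \notin S))%:R.
Proof.
rewrite big_mkcond; apply: eq_bigr => u _.
case: (u \in S) => /=; last by rewrite big1 // => v _; rewrite mulr0.
rewrite big_mkcond; apply: eq_bigr => v _.
by rewrite finset.inE; case: (v \in S); rewrite /= ?mulr0 ?mulr1.
Qed.

Section ObliviousCut.
Variables (R : realFieldType) (V : finType) (c : V -> V -> R).
Hypothesis c_ge0 : forall u v, 0 <= c u v.

Definition outflow v := \sum_k c v k.
Definition inflow v := \sum_k c k v.
Definition out_ratio v := outflow v / (outflow v + inflow v).

Lemma outflow_ge0 v : 0 <= outflow v.
Proof. exact: sumr_ge0. Qed.

Lemma inflow_ge0 v : 0 <= inflow v.
Proof. exact: sumr_ge0. Qed.

Lemma out_ratio_itv v : 0 <= out_ratio v <= 1.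
Proof.
have o0 := outflow_ge0 v; have i0 := inflow_ge0 v.
rewrite divr_ge0 ?addr_ge0 //=.
have [t0|t0] := ltrP 0 (outflow v + inflow v).
  by rewrite ler_pdivrMr // mul1r lerDl.
by rewrite /out_ratio (_ : outflow v = 0) ?mul0r //; lra.
Qed.

Lemma out_ratio_balance v :
  (1 - out_ratio v) * outflow v = out_ratio v * inflow v.
Proof.
have o0 := outflow_ge0 v; have i0 := inflow_ge0 v.
(* A node of total weight 0 has ratio 0 / 0 = 0, but then both flows vanish. *)
have [t0|t0] := eqVneq (outflow v + inflow v) 0.
  have [-> ->] : outflow v = 0 /\ inflow v = 0 by lra.
  by rewrite !mulr0.
by apply: (mulIf t0); rewrite /out_ratio; field.
Qed.

Variable T : {set V}.

Definition potential v :=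
  if v \in T then multiplier (out_ratio v) else - multiplier (1 - out_ratio v).

(** Grouped by node, the potential of v has coefficient (1 - x_v) times the outflow minus x_v times
    the inflow, which is 0 by [out_ratio_balance]. *)
Lemma potential_sum0 :
  \sum_u \sum_v
    c u v * ((1 - out_ratio u) * potential u - out_ratio v * potential v) = 0.
Proof.
under eq_bigr => u _ do under eq_bigr => v _ do rewrite mulrBr.
under eq_bigr => u _ do rewrite sumrB.
rewrite sumrB [X in _ - X]exchange_big /= -sumrB big1 // => v _.
rewrite -!mulr_suml -/(outflow v) -/(inflow v).
have balance := out_ratio_balance v.
have -> : outflow v * ((1 - out_ratio v) * potential v) =
    (1 - out_ratio v) * outflow v * potential v by ring.
by rewrite balance; ring.
Qed.

Lemma arc_bound u v :
  483 / 1000 * ((u \in T) && (v \notin T))%:R +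
    ((1 - out_ratio u) * potential u - out_ratio v * potential v) <=
  select_prob (out_ratio u) * (1 - select_prob (out_ratio v)).
Proof.
have xu := out_ratio_itv u; have xv := out_ratio_itv v.
have yv : 0 <= 1 - out_ratio v <= 1 by lra.
have pu := select_prob_itv (out_ratio u).
have pv := select_prob_itv (1 - out_ratio v).
have gu := out_term_le xu; have gv := out_term_le yv.
have hu := in_term_ge xu; have hv := in_term_ge yv.
have h1 := out_out_le (select_prob (out_ratio u))
  (select_prob (1 - out_ratio v)).
have h2 := out_in_le pu pv; have h3 := out_in_le pv pu.
have h4 := in_in_le (select_prob (out_ratio u)) (select_prob (1 - out_ratio v)).
rewrite -select_probC /potential; move: gu gv hu hv.
rewrite /out_term /in_term (_ : 1 - (1 - out_ratio v) = out_ratio v); last ring.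
by case: (u \in T); case: (v \in T) => /=; lra.
Qed.

Lemma oblivious_cut :
  483 / 1000 * (\sum_(u in T) \sum_(v in ~: T) c u v) <=
  \sum_u \sum_v
    c u v * (select_prob (out_ratio u) * (1 - select_prob (out_ratio v))).
Proof.
rewrite sum_in_notin.
rewrite -[leLHS]addr0 -[X in _ + X <= _]potential_sum0 mulr_sumr -big_split /=.
apply: ler_sum => u _; rewrite mulr_sumr -big_split /=.
apply: ler_sum => v _; rewrite mulrCA -mulrDr.
by apply: ler_wpM2l => //; exact: arc_bound.
Qed.

End ObliviousCut.

(** * The program *)

Definition block (l : seq instr) : cmd := foldr (fun i => Seq (Do i)) Skip l.

(* Integer cells: 0 is |V|, 1 and 2 are the constants 1 and 5, 3 is the new   *)
(* node, 4 a pointer, 5 and 7 the loop counters, 6 is junk. Real cells: 0 and *)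
(* 1 accumulate the out- and in-weight of the node in cell 5, 2 and 3 are     *)
(* scratch, and 5 + v is the threshold of v. The accumulators start at minus  *)
(* the weight of the self-loop, which the loop then adds back.                *)
Definition inner_body : cmd := block
  [:: Query (Dir 6) (Dir 2) (Dir 5) (Dir 7);
      ROp RAdd (Dir 0) (Dir 0) (Dir 2);
      Query (Dir 6) (Dir 2) (Dir 7) (Dir 5);
      ROp RAdd (Dir 1) (Dir 1) (Dir 2);
      IAdd (Dir 7) (Dir 7) (Dir 1)].

Definition outer_body : cmd :=
  Seq (block
    [:: Query (Dir 6) (Dir 2) (Dir 5) (Dir 5);
        RConst (Dir 3) 0;
        ROp RSub (Dir 0) (Dir 3) (Dir 2);
        RMove (Dir 1) (Dir 0);
        IConst (Dir 7) 0])
  (Seq (While (ILt (Dir 7) (Dir 0)) inner_body)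
  (Seq (block
    [:: ROp RAdd (Dir 1) (Dir 0) (Dir 1);
        ROp RDiv (Dir 1) (Dir 0) (Dir 1);
        IAdd (Dir 4) (Dir 2) (Dir 5)])
  (Seq (If (RLt (Ind 4) (Dir 1)) Skip (Do (Delete (Dir 5))))
       (Do (IAdd (Dir 5) (Dir 5) (Dir 1)))))).

(** All nodes of V are tested again at each arrival. A test can only delete, so testing nodes
    outside the solution, revealed or not, changes nothing. *)
Definition program : cmd :=
  Seq (block
    [:: GetSize (Dir 0);
        IConst (Dir 1) 1;
        IConst (Dir 2) 5;
        GetNode (Dir 3);
        IAdd (Dir 4) (Dir 2) (Dir 3)])
  (Seq (block
    [:: RConst (Dir 1) 4^-1;
        RConst (Dir 2) 2^-1;
        Draw (Dir 0);
        ROp RMul (Dir 0) (Dir 2) (Dir 0);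
        ROp RAdd (Ind 4) (Dir 1) (Dir 0)])
  (Seq (block
    [:: Insert (Dir 3);
        IConst (Dir 5) 0])
  (While (ILt (Dir 5) (Dir 0)) outer_body))).

Local Arguments exec : simpl never.

(** * Hoare triples with step counts *)

Section Triples.
Variables (R : realType) (G : digraph R).
Variables (r : nat -> R) (seen : seq (node G)) (u : node G).
Local Notation state := (state G).
Local Notation step := (step r seen u).
Local Notation exec := (exec r seen u).
Implicit Types (P Q : state -> Prop) (c : cmd) (s : state).

(** The pending stack [k] is arbitrary, which lets runs be chained under [Seq] and [While]. *)
Definition runs c s s' (B : nat) : Prop :=
  exists2 t, (t <= B)%N & forall k, iter t step (c :: k, s) = (k, s').

Definition triple P c B Q : Prop :=
  forall s, P s -> exists2 s', Q s' & runs c s s' B.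

Lemma exec_query a b x y s : exec (Query a b x y) s =
  let ans := answer seen (nget s x) (nget s y) in
  State (upd (imem s) (loc s a) ans.1) (upd (rmem s) (loc s b) ans.2)
        (sol s) (drawn s).
Proof. by rewrite /Defs.exec; case: answer. Qed.

Lemma triple_weaken P Q c B B' :
  (B <= B')%N -> triple P c B Q -> triple P c B' Q.
Proof.
move=> leB H s /H[s' Qs' [t tB E]]; exists s' => //.
by exists t => //; exact: leq_trans leB.
Qed.

Lemma triple_skip P Q : (forall s, P s -> Q s) -> triple P Skip 1 Q.
Proof. by move=> PQ s Ps; exists s; [exact: PQ|exists 1%N]. Qed.

Lemma triple_do i P Q :
  (forall s, P s -> Q (exec i s)) -> triple P (Do i) 1 Q.
Proof. by move=> PQ s Ps; exists (exec i s); [exact: PQ|exists 1%N]. Qed.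

Lemma triple_seq P M Q c1 c2 B1 B2 :
  triple P c1 B1 M -> triple M c2 B2 Q ->
  triple P (Seq c1 c2) (B1 + B2).+1 Q.
Proof.
move=> H1 H2 s /H1[s1 Ms1 [t1 tB1 E1]]; have [s2 Qs2 [t2 tB2 E2]] := H2 _ Ms1.
exists s2 => //; exists (t1 + t2).+1; first by rewrite ltnS leq_add.
by move=> k; rewrite iterSr addnC iterD /= E1 E2.
Qed.

Lemma triple_if P Q t c1 c2 B :
  triple (fun s => P s /\ holds t s) c1 B Q ->
  triple (fun s => P s /\ ~~ holds t s) c2 B Q ->
  triple P (If t c1 c2) B.+1 Q.
Proof.
move=> H1 H2 s Ps; have [ht|ht] := boolP (holds t s).
  have [s' Qs' [n nB E]] := H1 _ (conj Ps ht).
  by exists s' => //; exists n.+1 => // k; rewrite iterSr /= ht E.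
have [s' Qs' [n nB E]] := H2 _ (conj Ps ht).
by exists s' => //; exists n.+1 => // k; rewrite iterSr /= (negPf ht) E.
Qed.

Lemma triple_for (Inv : nat -> state -> Prop) n t c B :
  (forall j s, (j <= n)%N -> Inv j s -> holds t s = (j < n)%N) ->
  (forall j, (j < n)%N -> triple (Inv j) c B (Inv j.+1)) ->
  triple (Inv 0%N) (While t c) (n * B.+1).+1 (Inv n).
Proof.
move=> testE body.
suff H m j : (j + m = n)%N ->
    triple (Inv j) (While t c) (m * B.+1).+1 (Inv n) by exact: H.
elim: m j => [|m IH] j jm s Is.
  have jn : j = n by lia.
  exists s; first by rewrite -jn.
  by exists 1%N => // k /=; rewrite (testE _ _ _ Is) jn // ltnn.
have lt_jn : (j < n)%N by lia.
have [s1 Is1 [t1 tB1 E1]] := body _ lt_jn _ Is.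
have jm1 : (j.+1 + m = n)%N by lia.
have [s2 Is2 [t2 tB2 E2]] := IH _ jm1 _ Is1.
exists s2 => //; exists (t1 + t2).+1; first by lia.
move=> k; rewrite iterSr addnC iterD /=.
by rewrite (testE _ _ (ltnW lt_jn) Is) lt_jn E1 E2.
Qed.

(** Each instruction takes two steps, one to unfold [Seq] and one to execute; the final [Skip] takes
    one. *)
Lemma triple_block (l : seq instr) P Q :
  (forall s, P s -> Q (foldl (fun s i => exec i s) s l)) ->
  triple P (block l) (size l).*2.+1 Q.
Proof.
elim: l P => [|i l IH] P PQ; first exact: triple_skip.
apply: (@triple_weaken _ _ _ (1 + (size l).*2.+1).+1) => //=.
apply: (@triple_seq _ (fun s => Q (foldl (fun s i => exec i s) s l))).
  exact: triple_do.
exact: IH.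
Qed.

Lemma iter_step_halted t s : iter t step ([::], s) = ([::], s).
Proof. by elim: t => //= t ->. Qed.

Lemma runs_halts c s s' B T :
  runs c s s' B -> (B <= T)%N -> halts_within c r seen u s T.
Proof.
move=> [t tB E] BT; rewrite /halts_within -(subnK (leq_trans tB BT)).
by rewrite iterD E iter_step_halted.
Qed.

(** [respond] stops at the least halting time, but a halted machine no longer moves, so any halting
    time yields the same state. *)
Lemma runs_respond c s s' B : runs c s s' B -> respond c r seen u s = s'.
Proof.
move=> [t tB E]; rewrite /respond; case: pselect => [ex|[]]; last first.
  by exists t; rewrite /halts_within E.
case: ex_minnP => m; rewrite /halts_within.
case Em: (iter m step _) => [[|? ?] s1] //= _ min_m.
have /min_m mt : halts_within c r seen u s t by rewrite /halts_within E.
by move: (E [::]); rewrite -(subnK mt) iterD Em iter_step_halted => -[].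
Qed.

End Triples.

(** * Effect and cost of one arrival *)

Section Correctness.
Variables (R : realType) (G : digraph R).
Variables (r : nat -> R) (seen : seq (node G)) (u : node G).
Local Notation state := (state G).
Local Notation n := (nb_nodes G).
Local Notation triple := (triple r seen u).

Definition reply (j k : nat) : R := (answer seen (insub j) (insub k)).2.

Definition seen_ratio (j : nat) : R :=
  let o := \sum_(0 <= k < n) reply j k - reply j j in
  let i := \sum_(0 <= k < n) reply k j - reply j j in
  o / (o + i).

Variables (th : nat -> R) (d : nat) (S : {set node G}).

Record common (j : nat) (s : state) : Prop := Common {
  common_size : imem s 0 = n;
  common_one : imem s 1 = 1%N;
  common_base : imem s 2 = 5%N;
  common_index : imem s 5 = j;
  common_threshold : forall k, rmem s (5 + k) = th k;
  common_drawn : drawn s = d }.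

Record inner_inv (S' : {set node G}) (j i : nat) (s : state) : Prop :=
  InnerInv {
  inner_common : common j s;
  inner_sol : sol s = S';
  inner_index : imem s 7 = i;
  inner_out : rmem s 0 = \sum_(0 <= k < i) reply j k - reply j j;
  inner_in : rmem s 1 = \sum_(0 <= k < i) reply k j - reply j j }.

Record outer_inv (j : nat) (s : state) : Prop := OuterInv {
  outer_common : common j s;
  outer_sol :
    sol s = [set v in S | (v < j)%N ==> (th v < seen_ratio v)]%SET }.

Lemma inner_body_spec S' j i :
  triple (inner_inv S' j i) inner_body 11 (inner_inv S' j i.+1).
Proof.
apply: triple_block => s [[c0 c1 c2 c5 cth cd] cS c7 co ci].
rewrite [foldl _ _ _]/= !exec_query /exec /iput /rput /nget /iget /rget /=.
rewrite /upd /=.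
split=> //=.
- by rewrite c7 c1 addn1.
- by rewrite co c5 c7 big_nat_recr //= addrAC.
- by rewrite ci c5 c7 big_nat_recr //= addrAC.
Qed.

Lemma inner_loop_spec S' j :
  triple (inner_inv S' j 0) (While (ILt (Dir 7) (Dir 0)) inner_body) (n * 12).+1
    (inner_inv S' j n).
Proof.
apply: triple_for => [i s _ [[c0 _ _ _ _ _] _ c7 _ _]|i _].
  by rewrite /= /iget /= c7 c0.
exact: inner_body_spec.
Qed.

Lemma outer_body_spec j : (j < n)%N ->
  triple (outer_inv j) outer_body (n * 12 + 30) (outer_inv j.+1).
Proof.
move=> lt_jn; set S' := [set v in S | (v < j)%N ==> (th v < seen_ratio v)]%SET.
apply: (@triple_weaken _ _ _ _ _ _ _ _
  (11 + ((n * 12).+1 + (7 + (2 + 1).+1).+1).+1).+1); first lia.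
apply: (@triple_seq _ _ _ _ _ _ (inner_inv S' j 0)).
  apply: triple_block => s [[c0 c1 c2 c5 cth cd] cS].
  rewrite [foldl _ _ _]/= !exec_query /exec /iput /rput /nget /iget /rget /=.
  rewrite /upd /=.
  by split=> //=; rewrite ?big_geq ?add0r ?c5 ?raddf0 // sub0r.
apply: (triple_seq (@inner_loop_spec S' j)).
apply: (@triple_seq _ _ _ _ _ _
  (fun s => [/\ common j s, sol s = S', imem s 4 = (5 + j)%N &
                rmem s 1 = seen_ratio j])).
  apply: triple_block => s [[c0 c1 c2 c5 cth cd] cS c7 co ci].
  rewrite /= /exec /iput /rput /nget /iget /rget /= /upd /=.
  by split=> //=; rewrite ?co ?ci ?c2 ?c5.
apply: (@triple_seq _ _ _ _ _ _
  (fun s => common j s /\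
     sol s = [set v in S | (v < j.+1)%N ==> (th v < seen_ratio v)]%SET)).
  apply: triple_if.
    apply: triple_skip => s [[cj cS c4 c1]].
    rewrite /= /rget /= c4 c1 (common_threshold cj) => th_lt; split=> //.
    rewrite cS; apply/setP => v; rewrite !inE ltnS [(v <= j)%N]leq_eqVlt.
    by have [vj|//] := eqVneq (v : nat) j; rewrite vj th_lt ltnn.
  apply: triple_do => s [[cj cS c4 c1]].
  rewrite /= /rget /= c4 c1 (common_threshold cj) => th_ge.
  rewrite /exec /nget /iget /= (common_index cj) insubT /=; split.
    by case: cj.
  rewrite cS; apply/setP => v.
  rewrite !inE ltnS [(v <= j)%N]leq_eqVlt -val_eqE /=.
  by have [vj|//] := eqVneq (v : nat) j; rewrite vj (negPf th_ge) andbF.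
apply: triple_do => s [[c0 c1 c2 c5 cth cd] cS].
rewrite /exec /iput /iget /= /upd /=.
by split=> //; split=> //=; rewrite c5 c1 addn1.
Qed.

End Correctness.

Definition arrival_time (n : nat) : nat :=
  (11 + (11 + (5 + (n * (n * 12 + 30).+1).+1).+1).+1).+1.

Definition threshold (R : realType) (x : R) : R := 4^-1 + 2^-1 * x.

Section Arrival.
Variables (R : realType) (G : digraph R).
Variables (r : nat -> R) (seen : seq (node G)) (u : node G) (s : state G).

Definition thresholds_after (k : nat) : R :=
  if k == u then threshold (r (drawn s)) else rmem s (5 + k).

Lemma program_spec : exists s',
  [/\ runs r seen u program s s' (arrival_time (nb_nodes G)),
      drawn s' = (drawn s).+1,
      forall k, rmem s' (5 + k) = thresholds_after k
    & sol s' = [set v in u |: sol s |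
                 thresholds_after v < seen_ratio seen v]%SET].
Proof.
pose inv := outer_inv seen thresholds_after (drawn s).+1 (u |: sol s)%SET.
have H : triple r seen u (eq s) program (arrival_time (nb_nodes G))
    (inv (nb_nodes G)).
  rewrite /program /arrival_time.
  pose setup (s' : state G) := [/\ imem s' 0 = nb_nodes G, imem s' 1 = 1%N,
    imem s' 2 = 5%N, imem s' 3 = u & imem s' 4 = (5 + u)%N].
  apply: (@triple_seq _ _ _ _ _ _ (fun s' => setup s' /\
      [/\ rmem s' = rmem s, sol s' = sol s & drawn s' = drawn s])).
    apply: triple_block => _ <-.
    rewrite [foldl _ _ _]/= /exec /iput /rput /nget /iget /rget /= /upd /=.
    by split; split.
  apply: (@triple_seq _ _ _ _ _ _ (fun s' => setup s' /\
      [/\ forall k, rmem s' (5 + k) = thresholds_after k, sol s' = sol s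
        & drawn s' = (drawn s).+1])).
    apply: triple_block => s0 [[c0 c1 c2 c3 c4] [cr cS cd]].
    rewrite [foldl _ _ _]/= /exec /iput /rput /nget /iget /rget /= /upd /=.
    rewrite cr cd c4; split; [by split|split=> // k].
    rewrite /= /thresholds_after /threshold eqn_add2l.
    by rewrite !fmorphV !rmorph_nat.
  apply: (@triple_seq _ _ _ _ _ _ (inv 0%N)).
    apply: triple_block => s0 [[c0 c1 c2 c3 c4] [cr cS cd]].
    rewrite [foldl _ _ _]/= /exec /iput /nget /iget c3 valK /= /upd /=.
    by split=> //=; rewrite cS; apply/setP => v; rewrite !inE andbT.
  apply: triple_for => [j s0 _ [[c0 _ _ c5 _ _] _]|j lt_j].
    by rewrite /= /iget /= c5 c0.
  exact: outer_body_spec.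
have [s' [[_ _ _ _ cth cd] cS] run] := H s erefl.
exists s'; split => //; rewrite cS; apply/setP => v.
by rewrite !inE ltn_ord.
Qed.

End Arrival.

(** * From query answers to flows, and the solution in closed form *)

Section Flow.
Variables (R : realType) (G : digraph R) (us : seq (node G)).

(** Self-loops are dropped because no set cuts them, and arcs leaving unrevealed nodes because
    queries do not show them. *)
Definition flow (a b : node G) : R :=
  if [&& a \in us, Defs.arc a b & a != b] then weight a b else 0.

Lemma flow_ge0 a b : 0 <= flow a b.
Proof. by rewrite /flow; case: ifP => // /and3P[_ ab _]; exact: weight_ge0. Qed.

Lemma replyE (a b : node G) :
  reply us a b = if (a \in us) && Defs.arc a b then weight a b else 0.
Proof. by rewrite /reply !valK /=; case: ifP. Qed.

Lemma seen_ratioE (v : node G) : seen_ratio us v = out_ratio flow v.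
Proof.
rewrite /seen_ratio /out_ratio /outflow /inflow !big_mkord.
congr (_ / (_ + _)).
all: rewrite (bigD1 v) //= addrAC subrr add0r [RHS](bigD1 v) //=.
all: rewrite [flow v v]/flow eqxx !andbF add0r.
all: apply: eq_bigr => k kv; rewrite replyE /flow.
all: by rewrite ?kv 1?eq_sym ?kv ?andbT.
Qed.

End Flow.

(** The outflow of a revealed node is final, while later arrivals can only add to its inflow. Hence
    a node that fails its test once fails it forever. *)
Lemma out_ratio_rcons (R : realType) (G : digraph R) (us : seq (node G))
    (u v : node G) : v \in us ->
  out_ratio (flow (rcons us u)) v <= out_ratio (flow us) v.
Proof.
move=> v_us; rewrite /out_ratio.
have -> : outflow (flow (rcons us u)) v = outflow (flow us) v.
  by apply: eq_bigr => k _; rewrite /flow mem_rcons inE v_us orbT.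
have o0 := outflow_ge0 (flow_ge0 us) v.
have i0 := inflow_ge0 (flow_ge0 us) v.
have ii : inflow (flow us) v <= inflow (flow (rcons us u)) v.
  apply: ler_sum => k _; rewrite {1}/flow.
  case: ifP => [/and3P[kus kv k_v]|_]; last exact: flow_ge0.
  by rewrite /flow mem_rcons inE kus kv k_v orbT.
have [->|o_neq0] := eqVneq (outflow (flow us) v) 0; first by rewrite !mul0r.
have o_gt0 : 0 < outflow (flow us) v by rewrite lt0r o_neq0.
by rewrite ler_pM2l // lef_pV2 ?posrE; lra.
Qed.

Section Solution.
Variables (R : realType) (G : digraph R) (r : nat -> R).
Implicit Types (us : seq (node G)) (u v : node G).

(** Each arrival draws exactly one number, so the rank of v in [us] is also the rank of its draw. *)
Definition selected us v : bool :=
  threshold (r (index v us)) < out_ratio (flow us) v.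

Record run_inv us (s : state G) : Prop := RunInv {
  run_drawn : drawn s = size us;
  run_threshold : forall v, v \in us ->
    rmem s (5 + v) = threshold (r (index v us));
  run_sol : sol s = [set v in us | selected us v]%SET }.

Lemma state_after_rcons p us u :
  state_after p r (rcons us u) =
  respond p r (rcons us u) u (state_after p r us).
Proof.
rewrite /state_after -cats1 foldl_cat /= /arrive.
suff -> : (foldl (arrive p r) ([::], init_state G) us).1 = us by rewrite cats1.
by elim/last_ind: us => //= us v IH; rewrite -cats1 foldl_cat /= IH cats1.
Qed.

Lemma run_invP us : uniq us -> run_inv us (state_after program r us).
Proof.
elim/last_ind: us => [_|us u IH].
  by split=> //; apply/setP => v; rewrite !inE.
rewrite rcons_uniq => /andP[u_us /IH[rd rth rS]]; rewrite state_after_rcons.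
have [s' [run cd cth cS]] :=
  program_spec r (rcons us u) u (state_after program r us).
rewrite (runs_respond run).
have th v : v \in rcons us u ->
    thresholds_after r u (state_after program r us) v =
    threshold (r (index v (rcons us u))).
  rewrite /thresholds_after rd mem_rcons inE -cats1 index_cat.
  have [->|vu] := eqVneq v u; first by rewrite (negPf u_us) /= !eqxx addn0.
  by move=> /= v_us; rewrite val_eqE (negPf vu) v_us rth.
split; first by rewrite cd rd size_rcons.
  by move=> v /th <-; rewrite cth.
rewrite cS; apply/setP => v; rewrite !inE mem_rcons inE rS !inE.
have [->|vu] /= := eqVneq v u.
  by rewrite th ?mem_rcons ?mem_head // seen_ratioE.
have [v_us|//] := boolP (v \in us); rewrite th ?mem_rcons ?inE ?v_us ?orbT //.
(* Passing the current test implies having passed the previous one, so intersecting with the old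
   solution is the same as applying the current test alone. *)
rewrite seen_ratioE /selected andb_idl // -cats1 index_cat v_us cats1.
by move=> /lt_le_trans; apply; exact: out_ratio_rcons.
Qed.

Lemma solutionE us : uniq us ->
  solution program r us = [set v in us | selected us v]%SET.
Proof. by move=> /run_invP[]. Qed.

End Solution.

Lemma program_online (R : realType) : online_algorithm R program.
Proof.
move=> G us u r _ _; rewrite /solution state_after_rcons.
have [s' [run _ _ cS]] :=
  program_spec r (rcons us u) u (state_after program r us).
rewrite (runs_respond run) cS; apply/fintype.subsetP => v.
by rewrite inE => /andP[].
Qed.

Lemma program_polynomial_time (R : realType) : polynomial_time R program.
Proof.
(* Coefficients by increasing degree; [arrival_time n] expands to 12 n^2 + 31 n + 31. *)
exists (Poly [:: 32; 31; 12]%N) => G us u r _ _.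
have [s' [run _ _ _]] :=
  program_spec r (rcons us u) u (state_after program r us).
apply: runs_halts run _; rewrite horner_Poly /= /arrival_time; lia.
Qed.

(** * Cut values, selection probabilities and the expected cut *)

Section Cut.
Variables (R : realType) (G : digraph R) (us : seq (node G)).

(** An arc cut by S leaves a revealed node and joins distinct nodes, so [flow] keeps its weight. *)
Lemma cut_flow (S : {set node G}) : S \subset [set u in us]%SET ->
  Defs.cut S = \sum_(u in S) \sum_(v in ~: S) flow us u v.
Proof.
move=> /fintype.subsetP S_us; rewrite /Defs.cut; apply: eq_bigr => u uS.
rewrite big_mkcondr /=; apply: eq_bigr => v; rewrite inE => vS.
have := S_us _ uS; rewrite inE /flow => -> /=.
case: ifP => //= _; rewrite ifT //.
by apply: contraNneq vS => <-.
Qed.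

End Cut.

Section Threshold.
Variable R : realType.
Local Open Scope classical_set_scope.

Definition below (y : R) : set R := [set x | threshold x < y].

Lemma belowE y : below y = `]-oo, 2 * y - 1 / 2[%classic.
Proof.
apply/seteqP; split=> x; rewrite /below /threshold /= in_itv /=; lra.
Qed.

Lemma measurable_below y : measurable (below y).
Proof. by rewrite belowE. Qed.

(** A draw x selects iff x < 2 y - 1/2; clipping this bound to [0, 1] gives the ramp. *)
Lemma uniform_below y :
  uniform_prob (@ltr01 R) (below y) = (select_prob y)%:E.
Proof.
have mI z : (`]-oo, z[%classic `&` `[0, 1]%classic =
    if z <= 1 then `[0, z[%classic else `[0, 1]%classic :> set R).
  case: ifP => z1; apply/seteqP; split=> x /=; rewrite ?in_itv /=; try lra.
rewrite /uniform_prob integral_uniform_pdf belowE mI.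
rewrite (eq_integral (cst 1%E)); last first.
  move=> x; rewrite inE /= /uniform_pdf subr0 invr1 => xI.
  rewrite ifT //; move: xI; case: ifP => ? /=; rewrite in_itv /=; lra.
have [y1|y1] := lerP (2 * y - 1 / 2) 1; rewrite integral_cst //= mul1e.
  rewrite lebesgue_measure_itv /= lte_fin /select_prob.
  have [?|?] := lerP (4 * y) 1; first by rewrite ifN //; lra.
  rewrite ifT; last lra.
  by rewrite -EFinB subr0; congr (_%:E); have [|] := lerP 3 (4 * y); lra.
rewrite lebesgue_measure_itv /= lte_fin ltr01 -EFinB subr0 /select_prob.
by rewrite ifN ?ifT //; lra.
Qed.

End Threshold.

Section ExpectedCut.
Variables (R : realType) (G : digraph R) (us : seq (node G)).
Hypothesis uniq_us : uniq us.
Variables (d : measure_display) (W : measurableType d) (P : probability W R).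
Variable U : nat -> {RV P >-> R}.
Hypothesis indU : independent U.
Hypothesis unifU : forall k, uniform01 (U k).
Local Open Scope classical_set_scope.

Local Notation x := (out_ratio (flow us)).
Local Notation p v := (select_prob (x v)).

(** Meaningful for revealed v only: for other nodes the index is that of a number never drawn. *)
Definition sel (v : node G) : set W := U (index v us) @^-1` below (x v).

Lemma prob_preimage k (B : set R) :
  measurable B -> P (U k @^-1` B) = uniform_prob (@ltr01 R) B.
Proof. by move=> mB; rewrite -(unifU k mB). Qed.

Lemma measurable_preimage k (B : set R) :
  measurable B -> measurable (U k @^-1` B).
Proof.
by move=> mB; rewrite -[X in measurable X]setTI; exact: measurable_funP.
Qed.

Lemma measurable_sel v : measurable (sel v).
Proof. by apply: measurable_preimage; exact: measurable_below. Qed.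

Lemma prob_sel v : P (sel v) = (p v)%:E.
Proof.
by rewrite prob_preimage ?uniform_below //; exact: measurable_below.
Qed.

(** The ratios are not random, so the two events depend on two different draws. *)
Lemma prob_sel_unsel u v : u \in us -> v \in us -> u != v ->
  P (sel u `&` ~` sel v) = (p u * (1 - p v))%:E.
Proof.
move=> u_us v_us uv.
pose B k := if k == index u us then below (x u) else ~` below (x v).
have iuv : index v us != index u us.
  by apply: contra uv => /eqP e; rewrite -(nth_index u u_us) -e nth_index.
have mB k : measurable (B k).
  rewrite /B; case: ifP => _; first exact: measurable_below.
  by apply: measurableC; exact: measurable_below.
have := @indU [:: index u us; index v us] B.
rewrite !big_cons !big_nil setIT mule1 /= inE eq_sym iuv => /(_ isT mB).
rewrite /B eqxx (negPf iuv) preimage_setC -/(sel u) -/(sel v) => ->.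
rewrite probability_setC ?prob_sel -?EFinB -?EFinM //.
exact: measurable_sel.
Qed.

Definition separated (u v : node G) (w : W) : bool :=
  let S := solution program (fun k => U k w) us in (u \in S) && (v \notin S).

Lemma separatedE u v w : separated u v w =
  [&& u \in us, w \in sel u & ~~ ((v \in us) && (w \in sel v))].
Proof.
rewrite /separated solutionE // !inE -andbA; congr [&& _, _ & ~~ (_ && _)].
all: by apply/idP/idP; rewrite /selected ?in_setE // => ?; apply/mem_set.
Qed.

Lemma integral_separated u v :
  measurable_fun setT
    (fun w => (flow us u v * (separated u v w)%:R)%:E : \bar R) /\
  (\int[P]_w (flow us u v * (separated u v w)%:R)%:E =
    (flow us u v * (p u * (1 - p v)))%:E)%E.
Proof.
have [->|] := eqVneq (flow us u v) 0.
  under eq_fun do rewrite mul0r.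
  split; first exact: measurable_cst.
  by rewrite integral0 mul0r.
rewrite {1}/flow; case: ifP => [/and3P[u_us _ uv] _|]; last by rewrite eqxx.
have [E mE [sepE PE]] : exists2 E : set W, measurable E &
    (forall w, (separated u v w)%:R = \1_E w :> R) /\
    P E = (p u * (1 - p v))%:E.
  have [v_us|v_us] := boolP (v \in us).
    exists (sel u `&` ~` sel v).
      apply: measurableI; first exact: measurable_sel.
      by apply: measurableC; exact: measurable_sel.
    split; last exact: prob_sel_unsel.
    by move=> w; rewrite indicE separatedE u_us v_us in_setI in_setC.
  exists (sel u); first exact: measurable_sel.
  split; first by move=> w; rewrite indicE separatedE u_us (negPf v_us) andbT.
  (* No arc leaving an unrevealed v counts, so x_v = 0 and p(x_v) = 0, in accordance with v never
     being selected. *)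
  rewrite prob_sel (_ : p v = 0) ?subr0 ?mulr1 //.
  rewrite /out_ratio (_ : outflow _ _ = 0).
    by rewrite mul0r /select_prob mulr0 ler01.
  by rewrite /outflow big1 // => k _; rewrite /flow (negPf v_us).
have eqf : (fun w => (flow us u v * (separated u v w)%:R)%:E) =
    (fun w => ((flow us u v)%:E * (\1_E w)%:E)%E).
  by apply/funext => w; rewrite sepE EFinM.
have mf : measurable_fun setT (fun w : W => (\1_E w)%:E : \bar R).
  by apply/measurable_EFinP; exact: measurable_indic.
rewrite eqf; split.
  exact: measurable_funeM.
rewrite ge0_integralZl_EFin //; last exact: flow_ge0.
rewrite integral_indic // setIT EFinM; congr (_ * _)%E; exact: PE.
Qed.

Lemma expected_cut :
  ('E_P[fun w => Defs.cut (solution program (fun k => U k w) us)])%E =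
  (\sum_u \sum_v flow us u v * (p u * (1 - p v)))%:E.
Proof.
have f_ge0 u v w : (0 <= (flow us u v * (separated u v w)%:R)%:E)%E.
  by rewrite lee_fin mulr_ge0 ?flow_ge0.
have cutE w : (Defs.cut (solution program (fun k => U k w) us))%:E =
    (\sum_u \sum_v (flow us u v * (separated u v w)%:R)%:E)%E.
  rewrite (cut_flow (us := us)); last first.
    rewrite solutionE //; apply/fintype.subsetP => v.
    by rewrite !inE => /andP[].
  by rewrite sum_in_notin -sumEFin; apply: eq_bigr => u _; rewrite -sumEFin.
rewrite unlock; under eq_integral do rewrite cutE.
rewrite ge0_integral_sum //; first last.
- by move=> u w _; exact: sume_ge0.
- move=> u; apply: emeasurable_sum => v.
  exact: (integral_separated u v).1.
rewrite -sumEFin; apply: eq_bigr => u _.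
rewrite ge0_integral_sum //; last by move=> v; exact: (integral_separated u v).1.
by rewrite -sumEFin; apply: eq_bigr => v _; exact: (integral_separated u v).2.
Qed.

End ExpectedCut.

Lemma program_competitive (R : realType) :
  competitive program (483%:R / 1000%:R : R).
Proof.
move=> G us uniq_us d W P U indU unifU; rewrite expected_cut // lee_fin.
set e := \sum_u _; have a0 : 0 < 483%:R / 1000%:R :> R by lra.
(* The maximum in [opt] has default value 0, which must be bounded too. *)
have e_ge0 : 0 <= e.
  apply: sumr_ge0 => u _; apply: sumr_ge0 => v _.
  have /andP[pu _] := select_prob_itv (out_ratio (flow us) u).
  have /andP[_ pv] := select_prob_itv (out_ratio (flow us) v).
  by rewrite !mulr_ge0 ?flow_ge0 ?subr_ge0.
rewrite mulrC -ler_pdivlMr //; apply/bigmax_leP; split.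
  exact: divr_ge0 e_ge0 (ltW a0).
move=> T T_us; rewrite (cut_flow T_us) ler_pdivlMr // mulrC.
exact: (oblivious_cut (flow_ge0 us)).
Qed.

Theorem theorem1p3 (R : realType) :
  exists p : cmd,
    [/\ online_algorithm R p, polynomial_time R p
      & competitive p (483%:R / 1000%:R : R)].
Proof.
exists program; split; [exact: program_online|exact: program_polynomial_time|].
exact: program_competitive.
Qed.
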